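(* Let $K$ be a field of characteristic $0$. Let $M=(\mu_0,\mu_1,\ldots,\mu_n)$ be a multiplicity vector, let $\lambda\in K$, and let $f(x)=\sum_{j=0}^n c_j(x-\lambda)^j\in K[x]$ be a polynomial of degree $n$. Then $M$ equals the multiplicity vector $M_f(\lambda)$ of $f$ at $\lambda$ if and only if, for every $j\in\{0,1,\ldots,n\}$, $c_j=0$ holds exactly when $\mu_j\ge 1$.
   Context: A multiplicity vector is a vector $(\mu_0,\ldots,\mu_n)$ of nonnegative integers with $\mu_n=0$ such that $\mu_j\ge1$ implies $\mu_{j+1}=\mu_j-1$. For a polynomial $f$ of degree $n$ and $\lambda\in K$, the multiplicity vector of $f$ at $\lambda$ is $M_f(\lambda)=(\mu_0,\ldots,\mu_n)$ where $\mu_j$ is the multiplicity of $\lambda$ as a zero of the $j$th derivative $f^{(j)}(x)$ (multiplicity $0$ if $f^{(j)}(\lambda)\neq0$; otherwise the largest $\mu$ with $(x-\lambda)^\mu\mid f^{(j)}(x)$). *)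

(* Defs.v *)
From mathcomp Require Import all_boot all_algebra.

Set Implicit Arguments.
Unset Strict Implicit.
Unset Printing Implicit Defensive.

Import GRing.Theory.
Local Open Scope ring_scope.

Definition is_multiplicity_vector (n : nat) (M : n.+1.-tuple nat) : Prop :=
  tnth M ord_max = 0%N /\
  forall i j : 'I_n.+1, j = i.+1 :> nat ->
    (1 <= tnth M i)%N -> tnth M j = (tnth M i - 1)%N.

(* Intended for f of degree n (size f = n.+1) over a field of characteristic 0,
   so that every derivative involved is nonzero: mup x 0 is a junk value. *)
Definition multiplicity_vector (K : fieldType) (n : nat) (f : {poly K})
    (lambda : K) : n.+1.-tuple nat :=
  [tuple mup lambda f^`(j) | j < n.+1].

(* Main.v *)
Require Import Defs.
From mathcomp Require Import all_boot all_algebra.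

Import GRing.Theory.
Local Open Scope ring_scope.

(** A multiplicity vector is determined by the positions of its nonzero entries:
    the last entry is [0], and going down each entry is either [0] or one more
    than the next. In characteristic [0], [M_f(lambda)] is itself a multiplicity
    vector, and since [f^(j)(lambda) = j! c_j] its [j]-th entry is nonzero
    exactly when [c_j = 0]. *)

Lemma ord_downward_ind (n : nat) (P : 'I_n.+1 -> Prop) :
  P ord_max ->
  (forall i j : 'I_n.+1, j = i.+1 :> nat -> P j -> P i) ->
  forall i, P i.
Proof.
move=> P_max P_down i; have [k] := ubnPeq (n - i)%N.
elim: k i => [|k IHk] i.
  rewrite subn_eq0 => le_n_i; suff -> : i = ord_max by [].
  by apply/val_inj/anti_leq; rewrite -ltnS ltn_ord.
move=> n_sub_i; have lt_i_n : (i < n)%N by rewrite -subn_gt0 (eqP n_sub_i).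
apply: (P_down i (Ordinal (lt_i_n : (i.+1 < n.+1)%N))) => //; apply: IHk.
by rewrite /= subnS (eqP n_sub_i).
Qed.

Lemma is_multiplicity_vector_eq (n : nat) (M N : n.+1.-tuple nat) :
  is_multiplicity_vector M -> is_multiplicity_vector N ->
  (forall j, (0 < tnth M j)%N = (0 < tnth N j)%N) -> M = N.
Proof.
move=> [M_max M_step] [N_max N_step] eq_gt0; apply: eq_from_tnth.
elim/ord_downward_ind => [|i j j_eq eq_j]; first by rewrite M_max N_max.
have := eq_gt0 i; case: (posnP (tnth M i)) => [-> /esym|M_gt0 /esym N_gt0].
  by case: (tnth N i).
by rewrite -(subnK M_gt0) -(subnK N_gt0) -(M_step i j) // -(N_step i j) // eq_j.
Qed.

Lemma derivn_XsubCX (R : comNzRingType) (a : R) (m k : nat) :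
  (('X - a%:P) ^+ m)^`(k) = ('X - a%:P) ^+ (m - k) *+ m ^_ k.
Proof.
elim: k => [|k IHk]; first by rewrite subn0.
rewrite derivnS IHk derivMn deriv_exp derivXsubC mul1r.
by rewrite -mulrnA mulnC -ffactnSr subnS.
Qed.

Lemma horner_derivn_sum_XsubCX (R : comNzRingType) (n : nat) (c : 'I_n -> R)
    (a : R) (j : 'I_n) :
  (\sum_(i < n) c i *: ('X - a%:P) ^+ i)^`(j).[a] = c j *+ j`!.
Proof.
rewrite raddf_sum horner_sum (bigD1 j) //= big1 ?addr0 => [|i i_neq_j];
  rewrite derivnZ derivn_XsubCX hornerZ hornerMn horner_exp !hornerE subrr.
  by rewrite subnn expr0 ffactnn mulr_natr.
case: (ltngtP i j) => [lt_i_j|lt_j_i|/val_inj eq_i_j].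
- by rewrite ffact_small // mulr0n mulr0.
- by rewrite expr0n subn_eq0 leqNgt lt_j_i mul0rn mulr0.
- by rewrite eq_i_j eqxx in i_neq_j.
Qed.

Section DerivativeSizePchar0.

Variable R : idomainType.
Hypothesis pcharR0 : [pchar R] =i pred0.
Implicit Types p : {poly R}.

Lemma mulrn_eq0_pchar0 (x : R) (n : nat) :
  (x *+ n == 0) = (n == 0%N) || (x == 0).
Proof. by rewrite -mulr_natl mulf_eq0 (pcharf0P R).1. Qed.

Lemma size_deriv_pchar0 p : size p^`() = (size p).-1.
Proof.
rewrite /deriv; case size_p: (size p).-1 => [|m].
  by rewrite poly_def big_ord0 size_poly0.
rewrite size_poly_eq //= mulrn_eq0_pchar0 /= -size_p -lead_coefE lead_coef_eq0.
by apply: contra_eq_neq size_p => ->; rewrite size_poly0.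
Qed.

Lemma size_derivn_pchar0 p (k : nat) : size p^`(k) = (size p - k)%N.
Proof.
elim: k => [|k IHk]; first by rewrite subn0.
by rewrite derivnS size_deriv_pchar0 IHk subnS.
Qed.

Lemma derivn_eq0_pchar0 p (k : nat) : (p^`(k) == 0) = (size p <= k)%N.
Proof. by rewrite -size_poly_eq0 size_derivn_pchar0 subn_eq0. Qed.

End DerivativeSizePchar0.

Lemma mup0 (K : fieldType) (x : K) : mup x 0 = 0%N.
Proof.
rewrite /mup; case: arg_maxnP => [|[i]]; first exact: dvdp0.
by rewrite size_poly0; case: i.
Qed.

Lemma mup_gt0 (K : fieldType) (x : K) (p : {poly K}) :
  p != 0 -> (0 < mup x p)%N = root p x.
Proof. by move=> p_neq0; rewrite -XsubC_dvd // dvdp_XsubCl. Qed.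

Lemma mup_deriv (K : fieldType) (x : K) (p : {poly K}) :
  (mup x p)%:R != 0 :> K -> mup x p^`() = (mup x p).-1.
Proof.
have [->|p_neq0] := eqVneq p 0; first by rewrite mup0 eqxx.
have [m [q]] := multiplicity_XsubC p x.
rewrite p_neq0 /= => q_x_neq0 ->; rewrite mupMr // mup_XsubCX eqxx.
case: m => [|m] m_neq0; first by rewrite eqxx in m_neq0.
have -> : (q * ('X - x%:P) ^+ m.+1)^`() =
          (q^`() * ('X - x%:P) + q *+ m.+1) * ('X - x%:P) ^+ m.
  rewrite derivM deriv_exp derivXsubC mul1r mulrDl -mulrA -exprS.
  by rewrite mulrnAr mulrnAl.
rewrite mupMr ?mup_XsubCX ?eqxx //.
rewrite rootE !hornerE subrr mulr0 add0r hornerMn -mulr_natl.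
by rewrite mulf_eq0 negb_or m_neq0.
Qed.

Section MultiplicityVectorPchar0.

Variable K : fieldType.
Hypothesis pcharK0 : [pchar K] =i pred0.
Variables (n : nat) (f : {poly K}) (x : K).
Hypothesis size_f : size f = n.+1.

Lemma tnth_multiplicity_vector_gt0 (j : 'I_n.+1) :
  (0 < tnth (multiplicity_vector n f x) j)%N = root f^`(j) x.
Proof.
by rewrite tnth_mktuple mup_gt0 // derivn_eq0_pchar0 // size_f -ltnNge.
Qed.

Lemma multiplicity_vectorP : is_multiplicity_vector (multiplicity_vector n f x).
Proof.
split=> [|i j j_eq].
  have /eqP/size_poly1P[a a_neq0 deriv_f] : size f^`(n) = 1%N.
    by rewrite size_derivn_pchar0 // size_f subSnn.
  by rewrite tnth_mktuple deriv_f mupNroot // rootC.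
rewrite !tnth_mktuple j_eq derivnS subn1 => mup_pos; apply: mup_deriv.
by rewrite (pcharf0P K).1 // -lt0n.
Qed.

End MultiplicityVectorPchar0.

Theorem theorem2 (K : fieldType) (charK0 : [pchar K] =i pred0) (n : nat)
    (M : n.+1.-tuple nat) (hM : is_multiplicity_vector M)
    (lambda : K) (c : 'I_n.+1 -> K) (f : {poly K})
    (hf : f = \sum_(j < n.+1) c j *: ('X - lambda%:P) ^+ j)
    (degf : size f = n.+1) :
  M = multiplicity_vector n f lambda <->
  (forall j : 'I_n.+1, c j = 0 <-> (1 <= tnth M j)%N).
Proof.
have entry_gt0E j :
    (0 < tnth (multiplicity_vector n f lambda) j)%N = (c j == 0).
  rewrite tnth_multiplicity_vector_gt0 // rootE hf horner_derivn_sum_XsubCX.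
  by rewrite mulrn_eq0_pchar0 // eqn0Ngt fact_gt0.
split=> [-> j|coef0_iff]; first by rewrite entry_gt0E; split=> /eqP.
apply: is_multiplicity_vector_eq => // [|j]; first exact: multiplicity_vectorP.
by rewrite entry_gt0E; apply/idP/eqP => /coef0_iff.
Qed.
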